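(* Let $\mathcal{C}$ be the category of C-systems and their homomorphisms and let $\mathcal{B}$ be the category of unital pre-B-systems and their homomorphisms. The functor $\mathcal{C}\to\mathcal{B}$, $CC\mapsto uB(CC)$ (acting on a homomorphism of C-systems by restricting it to objects of each length and to sections), is a full embedding, i.e. a fully faithful functor.
   Context: A C0-system is a category $CC$ together with: a function $l:Ob(CC)\to\mathbb{N}$ (length), an object $pt$, a function $ft:Ob(CC)\to Ob(CC)$, for every object $X$ a morphism $p_X:X\to ft(X)$, and for every $X$ with $l(X)>0$ and every morphism $f:Y\to ft(X)$ an object $f^*X$ and a morphism $q(f,X):f^*X\to X$, such that: (i) $pt$ is the only object of length $0$; (ii) $l(ft(X))=l(X)-1$ if $l(X)>0$, and $ft(pt)=pt$; (iii) $pt$ is a final object; (iv) for $l(X)>0$ and $f:Y\to ft(X)$ one has $l(f^*X)>0$, $ft(f^*X)=Y$, $p_X\circ q(f,X)=f\circ p_{f^*X}$, and this commutative square is a pullback square; (v) $(id_{ft(X)})^*X=X$ and $q(id_{ft(X)},X)=id_X$; (vi) for $g:Z\to Y$, $f:Y\to ft(X)$: $(f\circ g)^*X=g^*(f^*X)$ and $q(f\circ g,X)=q(f,X)\circ q(g,f^*X)$. A C-system is a C0-system together with, for every morphism $f:Y\to X$ with $l(X)>0$, a morphism $s_f:Y\to (ft(f))^*X$, where $ft(f):=p_X\circ f$, such that $p_{(ft(f))^*X}\circ s_f=id_Y$, $q(ft(f),X)\circ s_f=f$, and whenever $X=g^*U$ for some $U$ with $l(U)>0$ and $g:ft(X)\to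 ft(U)$, one has $s_f=s_{q(g,U)\circ f}$. A homomorphism of C-systems is a functor commuting with $l$, $pt$, $ft$, $p$, $(-)^*$, $q$ and $s$. A non-unital pre-B-system consists of sets $B_n$ and $\widetilde B_{n+1}$ ($n\ge 0$), maps $ft:B_{n+1}\to B_n$, $\partial:\widetilde B_{n+1}\to B_{n+1}$, an element $pt\in B_0$, and for all $m\ge n\ge 0$ maps $T:\{(Y,X)\in B_{n+1}\times B_{m+1}\mid ft(Y)=ft^{m+1-n}(X)\}\to B_{m+2}$, $\widetilde T:\{(Y,r)\in B_{n+1}\times\widetilde B_{m+1}\mid ft(Y)=ft^{m+1-n}(\partial r)\}\to\widetilde B_{m+2}$, $S:\{(s,X)\in\widetilde B_{n+1}\times B_{m+2}\mid \partial(s)=ft^{m+1-n}(X)\}\to B_{m+1}$, $\widetilde S:\{(s,r)\in\widetilde B_{n+1}\times\widetilde B_{m+2}\mid \partial(s)=ft^{m+1-n}(\partial r)\}\to\widetilde B_{m+1}$. A unital pre-B-system additionally has maps $\delta:B_{n+1}\to\widetilde B_{n+2}$ ($n\ge0$). A homomorphism of unital pre-B-systems is a family of maps $B_n\to B'_n$, $\widetilde B_{n+1}\to\widetilde B'_{n+1}$ commuting with $ft,\partial,pt,T,\widetilde T,S,\widetilde S,\delta$. For a C-system $CC$, $uB(CC)$ is the unital pre-B-system with $B_n=\{X\mid l(X)=n\}$, $\widetilde B_{n+1}=\{(X,s)\mid l(X)=n+1,\ s:ft(X)\to X,\ p_X\circ s=id_{ft(X)}\}$, $ft$ the restriction of $ft$,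 $\partial(X,s)=X$, $pt=pt$, and operations defined as follows. For $l(X)\ge i$ and $f:Y\to ft^i(X)$ put $f^*(X,0)=Y$, $q(f,X,0)=f$, $f^*(X,i+1)=q(f,ft(X),i)^*(X)$, $q(f,X,i+1)=q(q(f,ft(X),i),X)$. For a section $s:ft(X)\to X$ of $p_X$ and $g:W\to ft(X)$, let $g^*(s):W\to g^*X$ be the unique morphism with $p_{g^*X}\circ g^*(s)=id_W$ and $q(g,X)\circ g^*(s)=s\circ g$; for $i\ge1$, $l(X)\ge i$, $f:Y\to ft^i(X)$ put $f^*(s,i)=q(f,ft(X),i-1)^*(s):f^*(ft(X),i-1)\to f^*(X,i)$. Then for $m\ge n\ge 0$: $T(Y,X)=p_Y^*(X,m+1-n)$; $\widetilde T(Y,(X,s))=(p_Y^*(X,m+1-n),p_Y^*(s,m+1-n))$; $S((Z,s),X)=s^*(X,m+1-n)$; $\widetilde S((Z,s),(X,r))=(s^*(X,m+1-n),s^*(r,m+1-n))$ (with $s:ft(Z)\to Z$, $Z=ft^{m+1-n}(X)$); and $\delta(X)=(p_X^*X,d_X)$ where $d_X:X\to p_X^*X$ is the unique morphism with $p_{p_X^*X}\circ d_X=id_X$ and $q(p_X,X)\circ d_X=id_X$. *)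

(* Defs.v *)
From Stdlib Require Import Arith Lia FunctionalExtensionality ProofIrrelevance
  IndefiniteDescription.

Record category := Category {
  obj : Type;
  hom : obj -> obj -> Type;
  ident : forall X, hom X X;
  compose : forall X Y Z, hom Y Z -> hom X Y -> hom X Z;
  compose_ident_l : forall X Y (f : hom X Y), compose X Y Y (ident Y) f = f;
  compose_ident_r : forall X Y (f : hom X Y), compose X X Y f (ident X) = f;
  compose_assoc : forall X Y Z W (h : hom Z W) (g : hom Y Z) (f : hom X Y),
    compose X Z W h (compose X Y Z g f) = compose X Y W (compose Y Z W h g) f
}.
Arguments hom {_} _ _.
Arguments ident {_} _.
Arguments compose {_ _ _ _} _ _.

Record functor (C D : category) := Functor {
  on_obj :> obj C -> obj D;
  on_hom : forall X Y : obj C, hom X Y -> hom (on_obj X) (on_obj Y);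
  on_hom_ident : forall X, on_hom X X (ident X) = ident (on_obj X);
  on_hom_compose : forall X Y Z (g : hom Y Z) (f : hom X Y),
    on_hom X Z (compose g f) = compose (on_hom Y Z g) (on_hom X Y f)
}.
Arguments on_obj {_ _} _ _.
Arguments on_hom {_ _} _ {_ _} _.

Definition full {C D : category} (F : functor C D) : Prop :=
  forall (X Y : obj C) (g : hom (F X) (F Y)),
    exists f : hom X Y, on_hom F f = g.

Definition faithful {C D : category} (F : functor C D) : Prop :=
  forall (X Y : obj C) (f f' : hom X Y), on_hom F f = on_hom F f' -> f = f'.

Definition fully_faithful {C D : category} (F : functor C D) : Prop :=
  full F /\ faithful F.

(** The axioms of a C-system contain equalities between objects, and equalities
    between morphisms whose (co)domains agree only up to such an equality. The
    underlying category is therefore given by one type of objects and one type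
    of morphisms, with composition [comp g f _] (for "g after f") defined when
    [cod f = dom g]. Laws are stated for arbitrary proofs of these side
    conditions; the proofs always exist, and are unique by proof irrelevance. *)
Record smallcat := SmallCat {
  Ob : Type;
  Mor : Type;
  dom : Mor -> Ob;
  cod : Mor -> Ob;
  idm : Ob -> Mor;
  comp : forall g f : Mor, cod f = dom g -> Mor;
  dom_idm : forall X, dom (idm X) = X;
  cod_idm : forall X, cod (idm X) = X;
  dom_comp : forall g f e, dom (comp g f e) = dom f;
  cod_comp : forall g f e, cod (comp g f e) = cod g;
  comp_idm_l : forall f (e : cod f = dom (idm (cod f))),
    comp (idm (cod f)) f e = f;
  comp_idm_r : forall f (e : cod (idm (dom f)) = dom f),
    comp f (idm (dom f)) e = f;
  comp_assoc : forall h g f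
      (e : cod f = dom g) (e1 : cod (comp g f e) = dom h)
      (e' : cod g = dom h) (e2 : cod f = dom (comp h g e')),
    comp h (comp g f e) e1 = comp (comp h g e') f e2
}.
Arguments dom {_} _.
Arguments cod {_} _.
Arguments idm {_} _.
Arguments comp {_} g f _.
Arguments dom_idm {_} _.
Arguments cod_idm {_} _.
Arguments dom_comp {_} g f _.
Arguments cod_comp {_} g f _.
Arguments comp_idm_l {_} f _.
Arguments comp_idm_r {_} f _.
Arguments comp_assoc {_} h g f _ _ _ _.

(** [composes g f h]: the composite "g after f" is defined and equals [h]. *)
Definition composes {C : smallcat} (g f h : Mor C) : Prop :=
  exists e : cod f = dom g, comp g f e = h.

(** [commutes g f g' f']: "g after f" and "g' after f'" are defined and equal. *)
Definition commutes {C : smallcat} (g f g' f' : Mor C) : Prop :=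
  exists (e : cod f = dom g) (e' : cod f' = dom g'), comp g f e = comp g' f' e'.

(** [u] and [v] are the projections of a pullback of [f] and [g]. *)
Definition is_pullback {C : smallcat} (f g u v : Mor C) : Prop :=
  commutes f u g v /\
  forall a b : Mor C, commutes f a g b ->
    exists! c : Mor C, composes u c a /\ composes v c b.

Definition is_final {C : smallcat} (X : Ob C) : Prop :=
  forall Y : Ob C, exists! f : Mor C, dom f = Y /\ cod f = X.

(** [star f X _ _] and [q f X _ _] are f^*X and q(f,X); the side conditions say
    that [len X > 0] and that [f] is a morphism to [ft X]. *)
Record C0system := C0System {
  cat :> smallcat;
  len : Ob cat -> nat;
  pt : Ob cat;
  ft : Ob cat -> Ob cat;
  p : Ob cat -> Mor cat;
  dom_p : forall X, dom (p X) = X;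
  cod_p : forall X, cod (p X) = ft X;
  star : forall (f : Mor cat) (X : Ob cat), 0 < len X -> cod f = ft X -> Ob cat;
  q : forall (f : Mor cat) (X : Ob cat), 0 < len X -> cod f = ft X -> Mor cat;
  dom_q : forall f X h e, dom (q f X h e) = star f X h e;
  cod_q : forall f X h e, cod (q f X h e) = X;
  len_eq0 : forall X, len X = 0 <-> X = pt;
  len_ft : forall X, 0 < len X -> len (ft X) = len X - 1;
  ft_pt : ft pt = pt;
  pt_final : is_final pt;
  len_star : forall f X h e, 0 < len (star f X h e);
  ft_star : forall f X h e, ft (star f X h e) = dom f;
  star_pullback : forall f X h e,
    is_pullback f (p X) (p (star f X h e)) (q f X h e);
  star_idm : forall X h e, star (idm (ft X)) X h e = X;
  q_idm : forall X h e, q (idm (ft X)) X h e = idm X;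
  star_comp : forall g f X (e : cod g = dom f) h ef efg h' eg,
    star (comp f g e) X h efg = star g (star f X h ef) h' eg;
  q_comp : forall g f X (e : cod g = dom f) h ef efg h' eg
      (e' : cod (q g (star f X h ef) h' eg) = dom (q f X h ef)),
    q (comp f g e) X h efg
    = comp (q f X h ef) (q g (star f X h ef) h' eg) e'
}.
Arguments len {_} _.
Arguments ft {_} _.
Arguments p {_} _.
Arguments dom_p {_} _.
Arguments cod_p {_} _.
Arguments star {_} f X _ _.
Arguments q {_} f X _ _.
Arguments dom_q {_} f X _ _.
Arguments cod_q {_} f X _ _.
Arguments len_eq0 {_} X.
Arguments len_ft {_} X _.
Arguments len_star {_} f X _ _.
Arguments ft_star {_} f X _ _.
Arguments star_pullback {_} f X _ _.
Arguments star_idm {_} X _ _.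
Arguments q_idm {_} X _ _.
Arguments star_comp {_} g f X _ _ _ _ _ _.
Arguments q_comp {_} g f X _ _ _ _ _ _ _.

Definition ftm {C : C0system} (f : Mor C) : Mor C :=
  comp (p (cod f)) f (eq_sym (dom_p (cod f))).

Lemma dom_ftm {C : C0system} (f : Mor C) : dom (ftm f) = dom f.
Proof. apply dom_comp. Qed.

Lemma cod_ftm {C : C0system} (f : Mor C) : cod (ftm f) = ft (cod f).
Proof. exact (eq_trans (cod_comp _ _ _) (cod_p _)). Qed.

(** [sop f _] is s_f. *)
Record Csystem := CSystem {
  c0 :> C0system;
  sop : forall f : Mor c0, 0 < len (cod f) -> Mor c0;
  dom_sop : forall f h, dom (sop f h) = dom f;
  cod_sop : forall f h, cod (sop f h) = star (ftm f) (cod f) h (cod_ftm f);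
  p_sop : forall f h,
    composes (p (star (ftm f) (cod f) h (cod_ftm f))) (sop f h) (idm (dom f));
  q_sop : forall f h,
    composes (q (ftm f) (cod f) h (cod_ftm f)) (sop f h) f;
  sop_star : forall f h (U : Ob c0) (g : Mor c0) (hU : 0 < len U)
      (eg : cod g = ft U),
    dom g = ft (cod f) -> cod f = star g U hU eg ->
    forall (e : cod f = dom (q g U hU eg)) h',
      sop f h = sop (comp (q g U hU eg) f e) h'
}.
Arguments sop {_} f _.
Arguments dom_sop {_} f _.
Arguments cod_sop {_} f _.
Arguments p_sop {_} f _.
Arguments q_sop {_} f _.
Arguments sop_star {_} f _ U g _ _ _ _ _ _.

Record smallfun (C D : smallcat) := SmallFun {
  fob :> Ob C -> Ob D;
  fmor : Mor C -> Mor D;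
  dom_fmor : forall f, dom (fmor f) = fob (dom f);
  cod_fmor : forall f, cod (fmor f) = fob (cod f);
  fmor_idm : forall X, fmor (idm X) = idm (fob X);
  fmor_comp : forall g f (e : cod f = dom g) (e' : cod (fmor f) = dom (fmor g)),
    fmor (comp g f e) = comp (fmor g) (fmor f) e'
}.
Arguments fob {_ _} _ _.
Arguments fmor {_ _} _ _.
Arguments dom_fmor {_ _} _ _.
Arguments cod_fmor {_ _} _ _.
Arguments fmor_idm {_ _} _ _.
Arguments fmor_comp {_ _} _ _ _ _ _.

Record Chom (C D : Csystem) := CHom {
  cfun :> smallfun C D;
  chom_len : forall X, len (cfun X) = len X;
  chom_pt : cfun (pt C) = pt D;
  chom_ft : forall X, cfun (ft X) = ft (cfun X);
  chom_p : forall X, fmor cfun (p X) = p (cfun X);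
  chom_star : forall f X h e h' e',
    cfun (star f X h e) = star (fmor cfun f) (cfun X) h' e';
  chom_q : forall f X h e h' e',
    fmor cfun (q f X h e) = q (fmor cfun f) (cfun X) h' e';
  chom_sop : forall f h h',
    fmor cfun (sop f h) = sop (fmor cfun f) h'
}.
Arguments cfun {_ _} _.
Arguments chom_len {_ _} _ _.
Arguments chom_pt {_ _} _.
Arguments chom_ft {_ _} _ _.
Arguments chom_p {_ _} _ _.
Arguments chom_star {_ _} _ _ _ _ _ _ _.
Arguments chom_q {_ _} _ _ _ _ _ _ _.
Arguments chom_sop {_ _} _ _ _ _.

Lemma smallfun_ext {C D : smallcat} (F G : smallfun C D) :
  (forall X, F X = G X) -> (forall f, fmor F f = fmor G f) -> F = G.
Proof.
  destruct F as [F0 F1], G as [G0 G1]; simpl; intros E0 E1.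
  apply functional_extensionality in E0, E1; subst.
  f_equal; apply proof_irrelevance.
Qed.

Lemma Chom_ext {C D : Csystem} (F G : Chom C D) :
  (forall X, F X = G X) -> (forall f, fmor F f = fmor G f) -> F = G.
Proof.
  intros E0 E1.
  assert (E : cfun F = cfun G) by (apply smallfun_ext; assumption).
  destruct F as [F], G as [G]; simpl in *; clear E0 E1; subst.
  f_equal; apply proof_irrelevance.
Qed.

Definition smallfun_id (C : smallcat) : smallfun C C.
Proof.
  refine (@SmallFun C C (fun X => X) (fun f => f) _ _ _ _); try reflexivity.
  intros g f e e'; f_equal; apply proof_irrelevance.
Defined.

Definition smallfun_comp {C D E : smallcat} (G : smallfun D E) (F : smallfun C D) :
  smallfun C E.
Proof.
  refine (@SmallFun C E (fun X => G (F X)) (fun f => fmor G (fmor F f)) _ _ _ _).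
  - intros f; rewrite dom_fmor, dom_fmor; reflexivity.
  - intros f; rewrite cod_fmor, cod_fmor; reflexivity.
  - intros X; rewrite fmor_idm, fmor_idm; reflexivity.
  - intros g f e e'.
    assert (e1 : cod (fmor F f) = dom (fmor F g))
      by (rewrite cod_fmor, dom_fmor, e; reflexivity).
    rewrite (fmor_comp F g f e e1); apply fmor_comp.
Defined.

Definition Chom_id (C : Csystem) : Chom C C.
Proof.
  refine (@CHom C C (smallfun_id C) _ _ _ _ _ _ _); try reflexivity;
    intros; simpl; f_equal; apply proof_irrelevance.
Defined.

Lemma chom_gt0 {C D : Csystem} (F : Chom C D) (X : Ob C) :
  0 < len X -> 0 < len (F X).
Proof. rewrite chom_len; trivial. Qed.

Lemma chom_cod_ft {C D : Csystem} (F : Chom C D) (f : Mor C) (X : Ob C) :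
  cod f = ft X -> cod (fmor F f) = ft (F X).
Proof. intros e; rewrite cod_fmor, e; apply chom_ft. Qed.

Definition Chom_comp {C D E : Csystem} (G : Chom D E) (F : Chom C D) : Chom C E.
Proof.
  refine (@CHom C E (smallfun_comp G F) _ _ _ _ _ _ _); simpl.
  - intros X; rewrite chom_len, chom_len; reflexivity.
  - rewrite chom_pt, chom_pt; reflexivity.
  - intros X; rewrite chom_ft, chom_ft; reflexivity.
  - intros X; rewrite chom_p, chom_p; reflexivity.
  - intros f X h e h' e'.
    rewrite (chom_star F f X h e (chom_gt0 F X h) (chom_cod_ft F f X e)).
    apply chom_star.
  - intros f X h e h' e'.
    rewrite (chom_q F f X h e (chom_gt0 F X h) (chom_cod_ft F f X e)).
    apply chom_q.
  - intros f h h'.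
    assert (h1 : 0 < len (cod (fmor F f))) by (rewrite cod_fmor, chom_len; exact h).
    rewrite (chom_sop F f h h1); apply chom_sop.
Defined.

Definition Csystems : category.
Proof.
  refine (@Category Csystem Chom Chom_id (@Chom_comp) _ _ _);
    intros; apply Chom_ext; reflexivity.
Defined.

Section IteratedFt.
  Variables (B : nat -> Type) (ftB : forall n, B (S n) -> B n).

  Fixpoint ftn (i n : nat) : B (i + n) -> B n :=
    match i return B (i + n) -> B n with
    | 0 => fun X => X
    | S i' => fun X => ftn i' n (ftB (i' + n) X)
    end.
End IteratedFt.

(** [Bt n] is the set usually written with index n+1: sections of elements of
    [B (S n)]. The operations indexed by m >= n are indexed here by [n] and
    [i = m - n], so that m = i + n and m + 1 - n = i + 1; in [S_op] and [St_op]
    the index m + 2 is written [S (i + S n)]. *)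
Record nuPreBsystem := NuPreBSystem {
  B : nat -> Type;
  Bt : nat -> Type;
  ftB : forall n, B (S n) -> B n;
  bd : forall n, Bt n -> B (S n);
  ptB : B 0;
  T_op : forall n i (Y : B (S n)) (X : B (S (i + n))),
    ftB n Y = ftn B ftB (S i) n X -> B (S (S (i + n)));
  Tt_op : forall n i (Y : B (S n)) (r : Bt (i + n)),
    ftB n Y = ftn B ftB (S i) n (bd (i + n) r) -> Bt (S (i + n));
  S_op : forall n i (s : Bt n) (X : B (S (i + S n))),
    bd n s = ftn B ftB (S i) (S n) X -> B (S (i + n));
  St_op : forall n i (s : Bt n) (r : Bt (i + S n)),
    bd n s = ftn B ftB (S i) (S n) (bd (i + S n) r) -> Bt (i + n)
}.
Arguments ftB {_} n _.
Arguments bd {_} n _.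
Arguments T_op {_} n i Y X _.
Arguments Tt_op {_} n i Y r _.
Arguments S_op {_} n i s X _.
Arguments St_op {_} n i s r _.

Record uPreBsystem := UPreBSystem {
  nuB :> nuPreBsystem;
  delta : forall n, B nuB (S n) -> Bt nuB (S n)
}.
Arguments delta {_} n _.

Record Bhom (P Q : uPreBsystem) := BHom {
  onB : forall n, B P n -> B Q n;
  onBt : forall n, Bt P n -> Bt Q n;
  bhom_ft : forall n X, onB n (ftB n X) = ftB n (onB (S n) X);
  bhom_bd : forall n s, onB (S n) (bd n s) = bd n (onBt n s);
  bhom_pt : onB 0 (ptB P) = ptB Q;
  bhom_T : forall n i Y X e e',
    onB _ (T_op n i Y X e) = T_op n i (onB _ Y) (onB _ X) e';
  bhom_Tt : forall n i Y r e e',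
    onBt _ (Tt_op n i Y r e) = Tt_op n i (onB _ Y) (onBt _ r) e';
  bhom_S : forall n i s X e e',
    onB _ (S_op n i s X e) = S_op n i (onBt _ s) (onB _ X) e';
  bhom_St : forall n i s r e e',
    onBt _ (St_op n i s r e) = St_op n i (onBt _ s) (onBt _ r) e';
  bhom_delta : forall n X, onBt _ (delta n X) = delta n (onB _ X)
}.
Arguments onB {_ _} _ {n} _.
Arguments onBt {_ _} _ {n} _.
Arguments bhom_ft {_ _} _ _ _.
Arguments bhom_bd {_ _} _ _ _.
Arguments bhom_pt {_ _} _.
Arguments bhom_T {_ _} _ _ _ _ _ _ _.
Arguments bhom_Tt {_ _} _ _ _ _ _ _ _.
Arguments bhom_S {_ _} _ _ _ _ _ _ _.
Arguments bhom_St {_ _} _ _ _ _ _ _ _.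
Arguments bhom_delta {_ _} _ _ _.

Lemma Bhom_ext {P Q : uPreBsystem} (F G : Bhom P Q) :
  (forall n (X : B P n), onB F X = onB G X) ->
  (forall n (s : Bt P n), onBt F s = onBt G s) -> F = G.
Proof.
  destruct F as [F0 F1], G as [G0 G1]; simpl; intros E0 E1.
  assert (F0 = G0) by (do 2 (apply functional_extensionality_dep; intro); apply E0).
  assert (F1 = G1) by (do 2 (apply functional_extensionality_dep; intro); apply E1).
  subst; f_equal; apply proof_irrelevance.
Qed.

Lemma bhom_ftn {P Q : uPreBsystem} (F : Bhom P Q) i n (X : B P (i + n)) :
  onB F (ftn (B P) (@ftB P) i n X) = ftn (B Q) (@ftB Q) i n (onB F X).
Proof.
  revert X; induction i as [|i IH]; simpl; intros X; [reflexivity|].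
  rewrite IH, bhom_ft; reflexivity.
Qed.

Definition Bhom_id (P : uPreBsystem) : Bhom P P.
Proof.
  refine (@BHom P P (fun _ X => X) (fun _ s => s) _ _ _ _ _ _ _ _);
    try reflexivity; intros; f_equal; apply proof_irrelevance.
Defined.

Definition Bhom_comp {P Q R : uPreBsystem} (G : Bhom Q R) (F : Bhom P Q) : Bhom P R.
Proof.
  refine (@BHom P R (fun _ X => onB G (onB F X)) (fun _ s => onBt G (onBt F s))
            _ _ _ _ _ _ _ _).
  - intros n X; rewrite bhom_ft, bhom_ft; reflexivity.
  - intros n s; rewrite bhom_bd, bhom_bd; reflexivity.
  - rewrite bhom_pt, bhom_pt; reflexivity.
  - intros n i Y X e e'.
    assert (e1 : ftB n (onB F Y) = ftn (B Q) (@ftB Q) (S i) n (onB F (X : B P (S i + n))))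
      by (rewrite <- bhom_ft, e; apply (bhom_ftn F (S i))).
    rewrite (bhom_T F n i Y X e e1); apply bhom_T.
  - intros n i Y r e e'.
    assert (e1 : ftB n (onB F Y)
                 = ftn (B Q) (@ftB Q) (S i) n (bd (i + n) (onBt F r)))
      by (rewrite <- bhom_ft, e, <- bhom_bd; apply (bhom_ftn F (S i))).
    rewrite (bhom_Tt F n i Y r e e1); apply bhom_Tt.
  - intros n i s X e e'.
    assert (e1 : bd n (onBt F s)
                 = ftn (B Q) (@ftB Q) (S i) (S n) (onB F (X : B P (S i + S n))))
      by (rewrite <- bhom_bd, e; apply (bhom_ftn F (S i))).
    rewrite (bhom_S F n i s X e e1); apply bhom_S.
  - intros n i s r e e'.
    assert (e1 : bd n (onBt F s)
                 = ftn (B Q) (@ftB Q) (S i) (S n) (bd (i + S n) (onBt F r)))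
      by (rewrite <- bhom_bd, e, <- bhom_bd; apply (bhom_ftn F (S i))).
    rewrite (bhom_St F n i s r e e1); apply bhom_St.
  - intros n X; rewrite bhom_delta, bhom_delta; reflexivity.
Defined.

Definition uPreBsystems : category.
Proof.
  refine (@Category uPreBsystem Bhom Bhom_id (@Bhom_comp) _ _ _);
    intros; apply Bhom_ext; reflexivity.
Defined.

Definition the {A : Type} {P : A -> Prop} (H : exists! x, P x) : A :=
  proj1_sig (constructive_indefinite_description (unique P) H).

Lemma the_spec {A : Type} {P : A -> Prop} (H : exists! x, P x) : P (the H).
Proof.
  exact (proj1 (proj2_sig (constructive_indefinite_description (unique P) H))).
Qed.

Lemma the_unique {A : Type} {P : A -> Prop} (H : exists! x, P x) (y : A) :
  P y -> the H = y.
Proof.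
  exact (proj2 (proj2_sig (constructive_indefinite_description (unique P) H)) y).
Qed.

Section IteratedPullback.
  Context {C : C0system}.

  Fixpoint ftI (i : nat) (X : Ob C) : Ob C :=
    match i with 0 => X | S i' => ftI i' (ft X) end.

  Lemma len_ft_ge {i : nat} (X : Ob C) : S i <= len X -> i <= len (ft X).
  Proof. intros h; rewrite len_ft; lia. Qed.

  Lemma gt0_of_ge {i : nat} (X : Ob C) : S i <= len X -> 0 < len X.
  Proof. lia. Qed.

  (** q(f,X,i), together with the fact that its codomain is X. *)
  Fixpoint qIsig (i : nat) (f : Mor C) (X : Ob C) {struct i} :
      i <= len X -> cod f = ftI i X -> {g : Mor C | cod g = X} :=
    match i return i <= len X -> cod f = ftI i X -> {g : Mor C | cod g = X} with
    | 0 => fun _ e => exist _ f e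
    | S i' => fun h e =>
        let g := qIsig i' f (ft X) (len_ft_ge X h) e in
        exist _ (q (proj1_sig g) X (gt0_of_ge X h) (proj2_sig g)) (cod_q _ _ _ _)
    end.

  Definition qI i f X h e : Mor C := proj1_sig (qIsig i f X h e).

  Definition cod_qI i f X h e : cod (qI i f X h e) = X :=
    proj2_sig (qIsig i f X h e).

  (** f^*(X,i) *)
  Definition starI (i : nat) (f : Mor C) (X : Ob C) :
      i <= len X -> cod f = ftI i X -> Ob C :=
    match i return i <= len X -> cod f = ftI i X -> Ob C with
    | 0 => fun _ _ => dom f
    | S i' => fun h e =>
        star (qI i' f (ft X) (len_ft_ge X h) e) X (gt0_of_ge X h) (cod_qI _ _ _ _ _)
    end.

  Lemma dom_qI i f X h e : dom (qI i f X h e) = starI i f X h e.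
  Proof. destruct i; [reflexivity | apply dom_q]. Qed.

  Lemma len_star_eq f (X : Ob C) h e : len (star f X h e) = S (len (dom f)).
  Proof.
    rewrite <- (ft_star f X h e), len_ft by apply len_star.
    pose proof (len_star f X h e); lia.
  Qed.

  Lemma len_starI i f X h e : len (starI i f X h e) = i + len (dom f).
  Proof.
    revert X h e; induction i as [|i IH]; intros X h e; [reflexivity|].
    simpl; rewrite len_star_eq, dom_qI, IH; reflexivity.
  Qed.

  Definition is_section (X : Ob C) (s : Mor C) : Prop :=
    dom s = ft X /\ cod s = X /\ composes (p X) s (idm (ft X)).

  Lemma section_cod_dom {X : Ob C} {s g : Mor C} :
    is_section X s -> cod g = ft X -> cod g = dom s.
  Proof. intros [H _] e; congruence. Qed.

  Lemma sec_pullback_ex {X : Ob C} {s g : Mor C} (h : 0 < len X)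
      (Hs : is_section X s) (e : cod g = ft X) :
    exists! c : Mor C,
      composes (p (star g X h e)) c (idm (dom g)) /\
      composes (q g X h e) c (comp s g (section_cod_dom Hs e)).
  Proof.
    apply (star_pullback g X h e).
    set (esg := section_cod_dom Hs e); clearbody esg.
    destruct Hs as [ds [cs [e1 E]]].
    exists (cod_idm (dom g)).
    assert (e2 : cod (comp s g esg) = dom (p X))
      by (rewrite cod_comp, dom_p; exact cs).
    exists e2.
    rewrite comp_idm_r.
    assert (e3 : cod g = dom (comp (p X) s e1)) by (rewrite dom_comp; exact esg).
    rewrite (comp_assoc (p X) s g esg e2 e1 e3).
    revert e3; rewrite E, <- e; intros e3; symmetry; apply comp_idm_l.
  Qed.

  (** g^*(s), for a section s of p_X and g to ft(X) *)
  Definition sec_pullback {X : Ob C} {s g : Mor C} (h : 0 < len X)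
      (Hs : is_section X s) (e : cod g = ft X) : Mor C :=
    the (sec_pullback_ex h Hs e).

  (** f^*(s,j+1), for a section s of p_X and f to ft^(j+1)(X) *)
  Definition sec_starI (j : nat) (f : Mor C) {X : Ob C} {s : Mor C}
      (Hs : is_section X s) (h : S j <= len X) (e : cod f = ftI (S j) X) : Mor C :=
    sec_pullback (gt0_of_ge X h) Hs (cod_qI j f (ft X) (len_ft_ge X h) e).

  Lemma sec_pullback_section {X : Ob C} {s g : Mor C} (h : 0 < len X)
      (Hs : is_section X s) (e : cod g = ft X) :
    is_section (star g X h e) (sec_pullback h Hs e).
  Proof.
    destruct (the_spec (sec_pullback_ex h Hs e)) as [[e1 E1] _].
    fold (sec_pullback h Hs e) in e1, E1.
    split; [|split].
    - rewrite ft_star, <- (dom_idm (dom g)), <- E1, dom_comp; reflexivity.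
    - rewrite e1; apply dom_p.
    - exists e1; rewrite ft_star; exact E1.
  Qed.

  Lemma sec_starI_section j f {X s} (Hs : is_section X s) h e :
    is_section (starI (S j) f X h e) (sec_starI j f Hs h e).
  Proof. apply sec_pullback_section. Qed.

  Lemma diag_ex {X : Ob C} (h : 0 < len X) :
    exists! c : Mor C,
      composes (p (star (p X) X h (cod_p X))) c (idm X) /\
      composes (q (p X) X h (cod_p X)) c (idm X).
  Proof.
    apply (star_pullback (p X) X h (cod_p X)).
    assert (e : cod (idm X) = dom (p X)) by (rewrite dom_p; apply cod_idm).
    exists e, e; reflexivity.
  Qed.

  (** d_X *)
  Definition diag {X : Ob C} (h : 0 < len X) : Mor C := the (diag_ex h).

  Lemma diag_section {X : Ob C} (h : 0 < len X) :
    is_section (star (p X) X h (cod_p X)) (diag h).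
  Proof.
    destruct (the_spec (diag_ex h)) as [[e1 E1] _].
    fold (diag h) in e1, E1.
    split; [|split].
    - rewrite ft_star, dom_p, <- (dom_idm X), <- E1, dom_comp; reflexivity.
    - rewrite e1; apply dom_p.
    - exists e1; rewrite ft_star, dom_p; exact E1.
  Qed.

  Definition obn (n : nat) : Type := {X : Ob C | len X = n}.

  Record secn (n : nat) : Type := SecN {
    sec_ob : Ob C;
    sec_mor : Mor C;
    sec_len : len sec_ob = S n;
    sec_ax : is_section sec_ob sec_mor
  }.
  Arguments SecN {n} _ _ _ _.
  Arguments sec_ob {n} _.
  Arguments sec_mor {n} _.
  Arguments sec_len {n} _.
  Arguments sec_ax {n} _.

  Lemma obn_eq {n} (X Y : obn n) : proj1_sig X = proj1_sig Y -> X = Y.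
  Proof. apply eq_sig_hprop; intros; apply proof_irrelevance. Qed.

  Lemma secn_eq {n} (r s : secn n) :
    sec_ob r = sec_ob s -> sec_mor r = sec_mor s -> r = s.
  Proof.
    destruct r, s; simpl; intros E1 E2; subst; f_equal; apply proof_irrelevance.
  Qed.

  Definition obn_ft n (X : obn (S n)) : obn n.
  Proof.
    exists (ft (proj1_sig X)).
    abstract (destruct X as [X h]; simpl; rewrite len_ft; lia).
  Defined.

  Definition secn_bd n (s : secn n) : obn (S n) := exist _ (sec_ob s) (sec_len s).

  Definition obn_pt : obn 0 := exist _ (pt C) (proj2 (len_eq0 (pt C)) eq_refl).

  Lemma ftn_ftI i n (X : obn (i + n)) :
    proj1_sig (ftn obn obn_ft i n X) = ftI i (proj1_sig X).
  Proof. revert X; induction i as [|i IH]; intros X; [reflexivity | apply IH]. Qed.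

  Lemma obn_ge {i n} (X : obn (i + n)) : i <= len (proj1_sig X).
  Proof. rewrite (proj2_sig X); lia. Qed.

  (** The side conditions of the four operations: p_Y, resp. a section s, is a
      morphism to the appropriate iterated ft. *)
  Lemma T_cod {i n} (Y : obn (S n)) (X : obn (i + n)) :
    obn_ft n Y = ftn obn obn_ft i n X ->
    cod (p (proj1_sig Y)) = ftI i (proj1_sig X).
  Proof.
    intros e; rewrite cod_p, <- ftn_ftI.
    exact (f_equal (@proj1_sig _ _) e).
  Qed.

  Lemma S_cod {i n} (s : secn n) (X : obn (i + S n)) :
    secn_bd n s = ftn obn obn_ft i (S n) X ->
    cod (sec_mor s) = ftI i (proj1_sig X).
  Proof.
    intros e; rewrite <- ftn_ftI, <- e.
    exact (proj1 (proj2 (sec_ax s))).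
  Qed.

  Lemma T_len i {n} (Y : obn (S n)) (X : Ob C) h e :
    len (starI (S i) (p (proj1_sig Y)) X h e) = S (S (i + n)).
  Proof. rewrite len_starI, dom_p, (proj2_sig Y); lia. Qed.

  Lemma S_len i {n} (s : secn n) (X : Ob C) h e :
    len (starI (S i) (sec_mor s) X h e) = S (i + n).
  Proof.
    rewrite len_starI, (proj1 (sec_ax s)), len_ft; rewrite (sec_len s); simpl; lia.
  Qed.

  Definition uB_T n i (Y : obn (S n)) (X : obn (S (i + n)))
      (e : obn_ft n Y = ftn obn obn_ft (S i) n X) : obn (S (S (i + n))) :=
    let h := obn_ge (i := S i) (n := n) X in
    let eY := T_cod (i := S i) Y X e in
    exist _ (starI (S i) (p (proj1_sig Y)) (proj1_sig X) h eY) (T_len i Y _ h eY).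

  Definition uB_Tt n i (Y : obn (S n)) (r : secn (i + n))
      (e : obn_ft n Y = ftn obn obn_ft (S i) n (secn_bd _ r)) : secn (S (i + n)) :=
    let h := obn_ge (i := S i) (n := n) (secn_bd _ r) in
    let eY := T_cod (i := S i) Y (secn_bd _ r) e in
    SecN (starI (S i) (p (proj1_sig Y)) (sec_ob r) h eY)
         (sec_starI i (p (proj1_sig Y)) (sec_ax r) h eY)
         (T_len i Y _ h eY)
         (sec_starI_section i _ (sec_ax r) h eY).

  Definition uB_S n i (s : secn n) (X : obn (S (i + S n)))
      (e : secn_bd n s = ftn obn obn_ft (S i) (S n) X) : obn (S (i + n)) :=
    let h := obn_ge (i := S i) (n := S n) X in
    let es := S_cod (i := S i) s X e in
    exist _ (starI (S i) (sec_mor s) (proj1_sig X) h es) (S_len i s _ h es).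

  Definition uB_St n i (s : secn n) (r : secn (i + S n))
      (e : secn_bd n s = ftn obn obn_ft (S i) (S n) (secn_bd _ r)) : secn (i + n) :=
    let h := obn_ge (i := S i) (n := S n) (secn_bd _ r) in
    let es := S_cod (i := S i) s (secn_bd _ r) e in
    SecN (starI (S i) (sec_mor s) (sec_ob r) h es)
         (sec_starI i (sec_mor s) (sec_ax r) h es)
         (S_len i s _ h es)
         (sec_starI_section i _ (sec_ax r) h es).

  Lemma obn_gt0 {n} (X : obn (S n)) : 0 < len (proj1_sig X).
  Proof. rewrite (proj2_sig X); lia. Qed.

  Lemma delta_len {n} (X : obn (S n)) h e :
    len (star (p (proj1_sig X)) (proj1_sig X) h e) = S (S n).
  Proof. rewrite len_star_eq, dom_p, (proj2_sig X); reflexivity. Qed.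

  Definition uB_delta n (X : obn (S n)) : secn (S n) :=
    SecN (star (p (proj1_sig X)) (proj1_sig X) (obn_gt0 X) (cod_p _))
         (diag (obn_gt0 X))
         (delta_len X (obn_gt0 X) (cod_p _))
         (diag_section (obn_gt0 X)).

  Definition uB : uPreBsystem :=
    UPreBSystem (NuPreBSystem obn secn obn_ft secn_bd obn_pt uB_T uB_Tt uB_S uB_St)
      uB_delta.
End IteratedPullback.
Arguments obn C n : clear implicits.
Arguments secn C n : clear implicits.
Arguments SecN {C n} _ _ _ _.
Arguments sec_ob {C n} _.
Arguments sec_mor {C n} _.
Arguments sec_len {C n} _.
Arguments sec_ax {C n} _.
Arguments uB C : clear implicits.

Section Functoriality.
  Context {C D : Csystem} (F : Chom C D).

  Lemma chom_composes (g f h : Mor C) :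
    composes g f h -> composes (fmor F g) (fmor F f) (fmor F h).
  Proof.
    intros [e E].
    assert (e' : cod (fmor F f) = dom (fmor F g))
      by (rewrite cod_fmor, dom_fmor, e; reflexivity).
    exists e'; rewrite <- E; symmetry; apply fmor_comp.
  Qed.

  Lemma star_congr (f f' : Mor D) X h e h' e' :
    f = f' -> star f X h e = star f' X h' e'.
  Proof. intros E; subst; f_equal; apply proof_irrelevance. Qed.

  Lemma q_congr (f f' : Mor D) X h e h' e' :
    f = f' -> q f X h e = q f' X h' e'.
  Proof. intros E; subst; f_equal; apply proof_irrelevance. Qed.

  Lemma qI_congr i (f f' : Mor D) X X' h e h' e' :
    f = f' -> X = X' -> qI i f X h e = qI i f' X' h' e'.
  Proof. intros E E'; subst; f_equal; apply proof_irrelevance. Qed.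

  Lemma starI_congr i (f f' : Mor D) X X' h e h' e' :
    f = f' -> X = X' -> starI i f X h e = starI i f' X' h' e'.
  Proof. intros E E'; subst; f_equal; apply proof_irrelevance. Qed.

  Lemma chom_ftI i X : F (ftI i X) = ftI i (F X).
  Proof.
    revert X; induction i as [|i IH]; intros X; [reflexivity|].
    simpl; rewrite IH, chom_ft; reflexivity.
  Qed.

  Lemma chom_qI i f X h e h' e' :
    fmor F (qI i f X h e) = qI i (fmor F f) (F X) h' e'.
  Proof.
    revert X h e h' e'; induction i as [|i IH]; intros X h e h' e'; [reflexivity|].
    change (qI (S i) f X h e) with
      (q (qI i f (ft X) (len_ft_ge X h) e) X (gt0_of_ge X h) (cod_qI _ _ _ _ _)).
    change (qI (S i) (fmor F f) (F X) h' e') with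
      (q (qI i (fmor F f) (ft (F X)) (len_ft_ge (F X) h') e') (F X)
         (gt0_of_ge (F X) h') (cod_qI _ _ _ _ _)).
    unshelve erewrite chom_q.
    - apply chom_gt0, (gt0_of_ge X h).
    - apply chom_cod_ft, cod_qI.
    - apply q_congr.
      assert (h1 : i <= len (F (ft X))) by (rewrite chom_len; apply (len_ft_ge X h)).
      assert (e1 : cod (fmor F f) = ftI i (F (ft X)))
        by (rewrite chom_ft; exact e').
      rewrite (IH (ft X) (len_ft_ge X h) e h1 e1).
      apply qI_congr; [reflexivity | apply chom_ft].
  Qed.

  Lemma chom_starI i f X h e h' e' :
    F (starI i f X h e) = starI i (fmor F f) (F X) h' e'.
  Proof.
    rewrite <- !dom_qI, <- dom_fmor; f_equal; apply chom_qI.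
  Qed.

  Lemma chom_section X s : is_section X s -> is_section (F X) (fmor F s).
  Proof.
    intros [H1 [H2 H3]]; split; [|split].
    - rewrite dom_fmor, H1; apply chom_ft.
    - rewrite cod_fmor, H2; reflexivity.
    - rewrite <- chom_p, <- chom_ft, <- fmor_idm; apply chom_composes, H3.
  Qed.

  Lemma chom_sec_pullback X s g h (Hs : is_section X s) (e : cod g = ft X)
      s' g' h' (Hs' : is_section (F X) s') (e' : cod g' = ft (F X)) :
    s' = fmor F s -> g' = fmor F g ->
    fmor F (sec_pullback h Hs e) = sec_pullback h' Hs' e'.
  Proof.
    intros Es Eg; subst; symmetry; apply the_unique.
    destruct (the_spec (sec_pullback_ex h Hs e)) as [H1 H2].
    fold (sec_pullback h Hs e) in H1, H2.
    apply chom_composes in H1, H2.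
    rewrite fmor_idm, chom_p in H1.
    rewrite (chom_star F g X h e h' e') in H1.
    rewrite (chom_q F g X h e h' e') in H2.
    rewrite (fmor_comp F _ _ _ (section_cod_dom Hs' e')) in H2.
    rewrite dom_fmor; split; assumption.
  Qed.

  Lemma chom_sec_starI j f X s (Hs : is_section X s) h e f' X' s'
      (Hs' : is_section X' s') h' e' :
    f' = fmor F f -> X' = F X -> s' = fmor F s ->
    fmor F (sec_starI j f Hs h e) = sec_starI j f' Hs' h' e'.
  Proof.
    intros Ef EX Es; subst; apply chom_sec_pullback; [reflexivity|].
    assert (h1 : j <= len (F (ft X))) by (rewrite chom_len; apply (len_ft_ge X h)).
    assert (e1 : cod (fmor F f) = ftI j (F (ft X))) by (rewrite chom_ft; exact e').
    rewrite (chom_qI j f (ft X) (len_ft_ge X h) e h1 e1).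
    apply qI_congr; [reflexivity | symmetry; apply chom_ft].
  Qed.

  Definition uB_onB n (X : obn C n) : obn D n :=
    exist _ (F (proj1_sig X)) (eq_trans (chom_len F _) (proj2_sig X)).

  Definition uB_onBt n (s : secn C n) : secn D n :=
    SecN (F (sec_ob s)) (fmor F (sec_mor s))
         (eq_trans (chom_len F _) (sec_len s))
         (chom_section (sec_ob s) (sec_mor s) (sec_ax s)).

  Definition uB_hom : Bhom (uB C) (uB D).
  Proof.
    refine (@BHom (uB C) (uB D) uB_onB uB_onBt _ _ _ _ _ _ _ _).
    - intros n X; apply obn_eq; apply chom_ft.
    - intros n s; apply obn_eq; reflexivity.
    - apply obn_eq; apply chom_pt.
    - intros n i Y X e e'; apply obn_eq; cbn -[starI].
      unshelve erewrite chom_starI.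
      + rewrite chom_len; apply (obn_ge (i := S i) (n := n) X).
      + rewrite cod_fmor, (T_cod (i := S i) Y X e); apply chom_ftI.
      + apply starI_congr; [apply chom_p | reflexivity].
    - intros n i Y r e e'; apply secn_eq; cbn -[starI sec_starI].
      + unshelve erewrite chom_starI.
        * rewrite chom_len; apply (obn_ge (i := S i) (n := n) (secn_bd _ r)).
        * rewrite cod_fmor, (T_cod (i := S i) Y (secn_bd _ r) e); apply chom_ftI.
        * apply starI_congr; [apply chom_p | reflexivity].
      + apply chom_sec_starI; [symmetry; apply chom_p | reflexivity | reflexivity].
    - intros n i s X e e'; apply obn_eq; cbn -[starI].
      apply chom_starI.
    - intros n i s r e e'; apply secn_eq; cbn -[starI sec_starI].
      + apply chom_starI.
      + apply chom_sec_starI; reflexivity.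
    - intros n X; apply secn_eq; cbn.
      + unshelve erewrite chom_star.
        * apply chom_gt0, obn_gt0.
        * apply chom_cod_ft, cod_p.
        * apply star_congr, chom_p.
      + symmetry; apply the_unique.
        destruct (the_spec (diag_ex (obn_gt0 X))) as [H1 H2].
        fold (diag (obn_gt0 X)) in H1, H2.
        apply chom_composes in H1, H2.
        rewrite fmor_idm in H1, H2; rewrite chom_p in H1.
        pose (h' := chom_gt0 F _ (obn_gt0 X)).
        pose (e' := chom_cod_ft F _ _ (cod_p (proj1_sig X))).
        rewrite (chom_star F _ _ _ _ h' e') in H1.
        rewrite (chom_q F _ _ _ _ h' e') in H2.
        split.
        * erewrite star_congr; [exact H1 | symmetry; apply chom_p].
        * erewrite q_congr; [exact H2 | symmetry; apply chom_p].
  Defined.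
End Functoriality.

Definition uB_functor : functor Csystems uPreBsystems.
Proof.
  refine (@Functor Csystems uPreBsystems (fun C : Csystem => uB C) (@uB_hom) _ _).
  - intros C; apply Bhom_ext; intros n x.
    + apply obn_eq; reflexivity.
    + apply secn_eq; reflexivity.
  - intros C D E G F; apply Bhom_ext; intros n x.
    + apply obn_eq; reflexivity.
    + apply secn_eq; reflexivity.
Defined.

(* Main.v *)
(** Base change along a morphism f, on objects and on sections, determines f:
    the pullback of the diagonal of cod f along f is s_f, and f is the composite
    of q(ft f, cod f) with s_f, where ft f has a shorter codomain. Given a
    homomorphism F of pre-B-systems, call f' in D related to f in C when F
    carries base change along f to base change along f'. Related pairs are closed
    under composition and q; they contain the identities, the projections p_X (by
    compatibility with T) and the sections (by compatibility with S). Writing f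
    as a composite of these, by induction on the length of cod f, yields exactly
    one f' related to each f, and f |-> f' is the homomorphism inducing F. *)

From Stdlib Require Import Lia ProofIrrelevance.
Require Import Defs.

(** * Composition as a functional relation, free of proofs of composability *)

Section Composites.
  Context {C : smallcat}.
  Implicit Types a b c f g h k u v : Mor C.

  Lemma composes_total g f : cod f = dom g -> exists k, composes g f k.
  Proof. intros e; exists (comp g f e), e; reflexivity. Qed.

  Lemma composes_fun g f a b : composes g f a -> composes g f b -> a = b.
  Proof. intros [e <-] [e' <-]; f_equal; apply proof_irrelevance. Qed.

  Lemma composes_dom g f k : composes g f k -> dom k = dom f.
  Proof. intros [e <-]; apply dom_comp. Qed.

  Lemma composes_cod g f k : composes g f k -> cod k = cod g.
  Proof. intros [e <-]; apply cod_comp. Qed.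

  Lemma composes_mid g f k : composes g f k -> cod f = dom g.
  Proof. intros [e _]; exact e. Qed.

  Lemma composes_idm_l f X : cod f = X -> composes (idm X) f f.
  Proof.
    intros <-; exists (eq_sym (dom_idm (cod f))); apply comp_idm_l.
  Qed.

  Lemma composes_idm_r f X : dom f = X -> composes f (idm X) f.
  Proof. intros <-; exists (cod_idm (dom f)); apply comp_idm_r. Qed.

  Lemma composes_assoc_l h g f gf hg k :
    composes g f gf -> composes h g hg -> composes h gf k -> composes hg f k.
  Proof.
    intros [e <-] [e' <-] [e1 <-].
    assert (e2 : cod f = dom (comp h g e')) by (rewrite dom_comp; exact e).
    exists e2; symmetry; apply comp_assoc.
  Qed.

  Lemma composes_assoc_r h g f gf hg k :
    composes g f gf -> composes h g hg -> composes hg f k -> composes h gf k.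
  Proof.
    intros [e <-] [e' <-] [e2 <-].
    assert (e1 : cod (comp g f e) = dom h) by (rewrite cod_comp; exact e').
    exists e1; apply comp_assoc.
  Qed.

  Lemma commutes_composes g f g' f' k :
    composes g f k -> composes g' f' k -> commutes g f g' f'.
  Proof. intros [e E] [e' E']; exists e, e'; congruence. Qed.

  (** The cone [(a, b)] commutes with [f] and [g] because it factors through [c], so the uniqueness
      clause of the pullback applies to both [c] and [c']. *)
  Lemma pullback_jointly_monic f g u v a b c c' :
    is_pullback f g u v ->
    composes u c a -> composes v c b -> composes u c' a -> composes v c' b ->
    c = c'.
  Proof.
    intros [[e [e' E]] H] Ha Hb Ha' Hb'.
    assert (fu : composes f u (comp f u e)) by (exists e; reflexivity).
    assert (gv : composes g v (comp f u e)) by (exists e'; symmetry; exact E).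
    destruct (composes_total f a) as [k Hk].
    { rewrite (composes_cod _ _ _ Ha); exact e. }
    assert (Hk' : composes (comp f u e) c k).
    { apply (composes_assoc_l f u c a); assumption. }
    assert (Hgb : composes g b k) by (apply (composes_assoc_r g v c b _ k Hb gv Hk')).
    destruct (H a b (commutes_composes _ _ _ _ _ Hk Hgb)) as [d [_ U]].
    rewrite <- (U c), <- (U c') by (split; assumption); reflexivity.
  Qed.

  Lemma final_unique X f f' :
    is_final X -> cod f = X -> cod f' = X -> dom f = dom f' -> f = f'.
  Proof.
    intros H e e' d; destruct (H (dom f)) as [k [_ U]].
    rewrite <- (U f), <- (U f') by (split; congruence); reflexivity.
  Qed.
End Composites.

(** * Calculus of iterated base change: composites, identities, [q] and diagonals *)

Section IteratedPullbackTheory.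
  Context {C : Csystem}.
  Implicit Types (f g k s : Mor C) (X Y : Ob C).

  (** Side proofs depending on [f] and [X] obstruct rewriting in place. This congruence rule and the
      next three take its place, with irrelevance absorbing the proofs. *)
  Lemma star_eq f f' X X' h e h' e' :
    f = f' -> X = X' -> star f X h e = star f' X' h' e'.
  Proof. intros; subst; f_equal; apply proof_irrelevance. Qed.

  Lemma q_eq f f' X X' h e h' e' :
    f = f' -> X = X' -> q f X h e = q f' X' h' e'.
  Proof. intros; subst; f_equal; apply proof_irrelevance. Qed.

  Lemma sec_pullback_eq X X' s s' g g' h (Hs : is_section X s) (e : cod g = ft X)
      h' (Hs' : is_section X' s') (e' : cod g' = ft X') :
    g = g' -> X = X' -> s = s' -> sec_pullback h Hs e = sec_pullback h' Hs' e'.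
  Proof. intros; subst; f_equal; apply proof_irrelevance. Qed.

  Lemma sec_starI_eq j X X' s s' f f' (Hs : is_section X s) h e
      (Hs' : is_section X' s') h' e' :
    f = f' -> X = X' -> s = s' -> sec_starI j f Hs h e = sec_starI j f' Hs' h' e'.
  Proof. intros; subst; f_equal; apply proof_irrelevance. Qed.

  Lemma sec_pullback_p X s g h (Hs : is_section X s) (e : cod g = ft X) :
    composes (p (star g X h e)) (sec_pullback h Hs e) (idm (dom g)).
  Proof. exact (proj1 (the_spec (sec_pullback_ex h Hs e))). Qed.

  Lemma sec_pullback_q X s g h (Hs : is_section X s) (e : cod g = ft X) k :
    composes s g k -> composes (q g X h e) (sec_pullback h Hs e) k.
  Proof.
    intros [e1 <-].
    rewrite (proof_irrelevance _ e1 (section_cod_dom Hs e)).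
    exact (proj2 (the_spec (sec_pullback_ex h Hs e))).
  Qed.

  Lemma sec_pullback_unique X s g h (Hs : is_section X s) (e : cod g = ft X) k c :
    composes s g k ->
    composes (p (star g X h e)) c (idm (dom g)) -> composes (q g X h e) c k ->
    sec_pullback h Hs e = c.
  Proof.
    intros [e1 <-] Hp Hq; apply the_unique; split; [exact Hp|].
    rewrite (proof_irrelevance _ (section_cod_dom Hs e) e1); exact Hq.
  Qed.

  Lemma ftI_S_ft i X : ftI (S i) X = ft (ftI i X).
  Proof.
    revert X; induction i as [|i IH]; intros X; [reflexivity|].
    exact (IH (ft X)).
  Qed.

  Lemma len_ftI i X : i <= len X -> len (ftI i X) = len X - i.
  Proof.
    revert X; induction i as [|i IH]; intros X h; simpl; [lia|].
    rewrite IH by (apply len_ft_ge, h); rewrite len_ft; lia.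
  Qed.

  Lemma ft_starI i f X h e h' e' :
    ft (starI (S i) f X h e) = starI i f (ft X) h' e'.
  Proof.
    simpl; rewrite ft_star, dom_qI; f_equal; apply proof_irrelevance.
  Qed.

  Lemma ftI_starI i f X h e : ftI i (starI i f X h e) = dom f.
  Proof.
    revert X h e; induction i as [|i IH]; intros X h e; [reflexivity|].
    change (ftI i (ft (starI (S i) f X h e)) = dom f).
    rewrite (ft_starI i f X h e (len_ft_ge X h) e); apply IH.
  Qed.

  Lemma q_composes f g k X h eg ek h' ef :
    composes g f k ->
    composes (q g X h eg) (q f (star g X h eg) h' ef) (q k X h ek).
  Proof.
    intros [e <-].
    assert (e' : cod (q f (star g X h eg) h' ef) = dom (q g X h eg))
      by (rewrite cod_q, dom_q; reflexivity).
    exists e'; symmetry; apply q_comp.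
  Qed.

  Lemma star_composes f g k X h eg ek h' ef :
    composes g f k -> star k X h ek = star f (star g X h eg) h' ef.
  Proof. intros [e <-]; apply star_comp. Qed.

  (** Axiom (vi), applied once per level. *)
  Lemma qI_composes i f g k X h eg ek h' ef :
    composes g f k ->
    composes (qI i g X h eg) (qI i f (starI i g X h eg) h' ef) (qI i k X h ek).
  Proof.
    intros H; revert X h eg ek h' ef.
    induction i as [|i IH]; intros X h eg ek h' ef; [exact H|].
    pose proof (ft_starI i g X h eg (len_ft_ge X h) eg) as E.
    assert (h1 : i <= len (starI i g (ft X) (len_ft_ge X h) eg))
      by (rewrite len_starI; lia).
    assert (e1 : cod f = ftI i (starI i g (ft X) (len_ft_ge X h) eg))
      by (rewrite <- E; exact ef).
    specialize (IH (ft X) (len_ft_ge X h) eg ek h1 e1).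
    assert (e2 : cod (qI i f (starI i g (ft X) (len_ft_ge X h) eg) h1 e1)
                 = ft (starI (S i) g X h eg))
      by (rewrite cod_qI; symmetry; exact E).
    pose proof (q_composes _ _ _ X (gt0_of_ge X h) (cod_qI _ _ _ _ _)
                  (cod_qI _ _ _ _ _) (len_star _ _ _ _) e2 IH) as Q.
    change (qI (S i) f (starI (S i) g X h eg) h' ef) with
      (q (qI i f (ft (starI (S i) g X h eg)) (len_ft_ge _ h') ef)
         (starI (S i) g X h eg) (gt0_of_ge _ h') (cod_qI _ _ _ _ _)).
    (* The two iterated [q] differ only in their base: [ft] of the pulled-back object, or the
       pullback of [ft X]. These agree by [E]. *)
    erewrite q_eq; [exact Q | | reflexivity].
    apply qI_congr; [reflexivity | exact E].
  Qed.

  Lemma starI_composes i f g k X h eg ek h' ef :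
    composes g f k -> starI i k X h ek = starI i f (starI i g X h eg) h' ef.
  Proof.
    intros H; rewrite <- !dom_qI.
    exact (composes_dom _ _ _ (qI_composes i f g k X h eg ek h' ef H)).
  Qed.

  (** The section pulled back in two stages satisfies both equations that characterize the pullback
      along [k]; for the [q] equation, [q] of [k] splits by [q_composes]. *)
  Lemma sec_pullback_composes f g k X s h (Hs : is_section X s) eg ek
      h' (Hs' : is_section (star g X h eg) (sec_pullback h Hs eg)) ef :
    composes g f k ->
    sec_pullback (g := k) h Hs ek = sec_pullback (g := f) h' Hs' ef.
  Proof.
    intros H.
    destruct (composes_total s g) as [sg Hsg].
    { rewrite eg; symmetry; apply Hs. }
    destruct (composes_total sg f) as [m Hm].
    { rewrite (composes_dom _ _ _ Hsg); exact (composes_mid _ _ _ H). }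
    apply (sec_pullback_unique X s k h Hs ek m).
    - exact (composes_assoc_r s g f k sg m H Hsg Hm).
    - rewrite (star_composes f g k X h eg ek h' ef H), (composes_dom _ _ _ H).
      apply sec_pullback_p.
    - destruct (composes_total (sec_pullback h Hs eg) f) as [n Hn].
      { rewrite ef; symmetry; apply Hs'. }
      pose proof (sec_pullback_q _ _ f h' Hs' ef n Hn) as Q1.
      pose proof (sec_pullback_q _ _ g h Hs eg sg Hsg) as Q2.
      apply (composes_assoc_l _ _ _ n _ m Q1 (q_composes f g k X h eg ek h' ef H)).
      exact (composes_assoc_r _ _ _ n _ m Hn Q2 Hm).
  Qed.

  Lemma sec_starI_composes j f g k X s (Hs : is_section X s) h eg ek
      (Hs' : is_section (starI (S j) g X h eg) (sec_starI j g Hs h eg)) h' ef :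
    composes g f k ->
    sec_starI j k Hs h ek = sec_starI j f Hs' h' ef.
  Proof.
    intros H.
    pose proof (ft_starI j g X h eg (len_ft_ge X h) eg) as E.
    assert (h1 : j <= len (starI j g (ft X) (len_ft_ge X h) eg))
      by (rewrite len_starI; lia).
    assert (e1 : cod f = ftI j (starI j g (ft X) (len_ft_ge X h) eg))
      by (rewrite <- E; exact ef).
    pose proof (qI_composes j f g k (ft X) (len_ft_ge X h) eg ek h1 e1 H) as Q.
    assert (e2 : cod (qI j f (starI j g (ft X) (len_ft_ge X h) eg) h1 e1)
                 = ft (starI (S j) g X h eg))
      by (rewrite cod_qI; symmetry; exact E).
    unfold sec_starI at 1.
    rewrite (sec_pullback_composes _ _ _ X s (gt0_of_ge X h) Hs
               (cod_qI j g (ft X) (len_ft_ge X h) eg) _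
               (len_star _ _ _ _) Hs' e2 Q).
    unfold sec_starI; apply sec_pullback_eq; try reflexivity.
    apply qI_congr; [reflexivity | symmetry; exact E].
  Qed.

  (** [Y] is kept as a variable since identities will occur at objects only provably equal to an
      iterated [ft]. *)
  Lemma qI_idm i X Y h e : Y = ftI i X -> qI i (idm Y) X h e = idm X.
  Proof.
    intros E; revert X h e E; induction i as [|i IH]; intros X h e E.
    { change (idm Y = idm X); rewrite E; reflexivity. }
    specialize (IH (ft X) (len_ft_ge X h) e E).
    transitivity (q (idm (ft X)) X (gt0_of_ge X h) (cod_idm _));
      [apply q_eq; [exact IH | reflexivity] | apply q_idm].
  Qed.

  Lemma starI_idm i X Y h e : Y = ftI i X -> starI i (idm Y) X h e = X.
  Proof. intros E; rewrite <- dom_qI, qI_idm by exact E; apply dom_idm. Qed.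

  Lemma sec_starI_idm j X Y s (Hs : is_section X s) h e :
    Y = ftI (S j) X -> sec_starI j (idm Y) Hs h e = s.
  Proof.
    intros E.
    pose proof (qI_idm j (ft X) Y (len_ft_ge X h) e E) as Q.
    transitivity (sec_pullback (gt0_of_ge X h) Hs (cod_idm (ft X)));
      [apply sec_pullback_eq; trivial|].
    destruct Hs as [ds [cs Hp]].
    apply (sec_pullback_unique _ _ _ _ _ _ s).
    - apply composes_idm_r, ds.
    - rewrite star_idm, dom_idm; exact Hp.
    - rewrite q_idm; apply composes_idm_l, cs.
  Qed.

  (** [q f X] is the first stage of the iteration that starts from [f], so iterating from it just
      shifts the level by one. This is what makes related pairs closed under [q]. *)
  Lemma qI_q i f X h e Y h1 e1 h2 e2 :
    X = ftI i Y -> qI i (q f X h e) Y h1 e1 = qI (S i) f Y h2 e2.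
  Proof.
    intros E; revert Y h1 e1 h2 e2 E.
    induction i as [|i IH]; intros Y h1 e1 h2 e2 E.
    - apply q_eq; [reflexivity | exact E].
    - apply q_eq; [|reflexivity].
      exact (IH (ft Y) (len_ft_ge Y h1) e1 (len_ft_ge Y h2) e2 E).
  Qed.

  Lemma starI_q i f X h e Y h1 e1 h2 e2 :
    X = ftI i Y -> starI i (q f X h e) Y h1 e1 = starI (S i) f Y h2 e2.
  Proof. intros E; rewrite <- !dom_qI; f_equal; apply qI_q, E. Qed.

  Lemma sec_starI_q j f X h e Y s (Hs : is_section Y s) h1 e1 h2 e2 :
    X = ftI (S j) Y ->
    sec_starI j (q f X h e) Hs h1 e1 = sec_starI (S j) f Hs h2 e2.
  Proof.
    intros E; apply sec_pullback_eq; try reflexivity.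
    apply (qI_q j f X h e (ft Y) _ _ (len_ft_ge Y h2) e2 E).
  Qed.

  Lemma ftm_composes f : composes (p (cod f)) f (ftm f).
  Proof. exists (eq_sym (dom_p (cod f))); reflexivity. Qed.

  (* s_f is the pullback of the diagonal along f: this is how delta recovers
     the operation s, hence the morphism f itself. *)
  Lemma sop_diag f X (hX : 0 < len X) h
      (Hs : is_section (star (p X) X hX (cod_p X)) (diag hX)) h' e' :
    cod f = X -> sec_starI 0 f Hs h' e' = sop f h.
  Proof.
    intros <-.
    assert (Eh : hX = h) by apply proof_irrelevance; subst hX.
    destruct (composes_total (diag h) f) as [k Hk].
    { rewrite (proj1 Hs), ft_star, dom_p; reflexivity. }
    assert (ef : cod f = ft (star (p (cod f)) (cod f) h (cod_p (cod f))))
      by (rewrite ft_star, dom_p; reflexivity).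
    pose proof (star_composes f _ _ (cod f) h (cod_p _) (cod_ftm f)
                  (len_star _ _ _ _) ef (ftm_composes f)) as Es.
    pose proof (q_composes f _ _ (cod f) h (cod_p _) (cod_ftm f)
                  (len_star _ _ _ _) ef (ftm_composes f)) as Q.
    transitivity (sec_pullback (len_star _ _ _ _) Hs ef);
      [apply sec_pullback_eq; reflexivity|].
    (* It remains to see that [sop f h] satisfies the two equations characterizing the pulled-back
       diagonal. *)
    apply (sec_pullback_unique _ _ _ _ _ _ k).
    - exact Hk.
    - rewrite <- Es; apply p_sop.
    - destruct (the_spec (diag_ex h)) as [D1 D2].
      fold (diag h) in D1, D2.
      pose proof (p_sop f h) as S1; pose proof (q_sop f h) as S2.
      rewrite Es in S1.
      set (W := star (p (cod f)) (cod f) h (cod_p (cod f))) in *.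
      destruct (composes_total (q f W (len_star _ _ _ _) ef) (sop f h)) as [k' Hk'].
      { rewrite cod_sop, Es, dom_q; reflexivity. }
      (* Here [k] is the diagonal after [f], and [k'] is [q f W] after [sop f h]. Both projections
         of [W] send each of them to [f], hence they coincide. *)
      replace k with k'; [exact Hk'|].
      pose proof (composes_idm_l f _ eq_refl) as If.
      apply (pullback_jointly_monic _ _ _ _ f f k' k
               (star_pullback (p (cod f)) (cod f) h (cod_p _))).
      + destruct (proj1 (star_pullback f W (len_star _ _ _ _) ef)) as [e1 [e2 E]].
        apply (composes_assoc_r _ _ _ _ (comp f (p _) e1) f Hk').
        * exists e2; symmetry; exact E.
        * apply (composes_assoc_l f (p _) _ _ _ f S1).
          -- exists e1; reflexivity.
          -- apply composes_idm_r; reflexivity.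
      + exact (composes_assoc_r _ _ _ _ _ f Hk' Q S2).
      + exact (composes_assoc_r _ _ _ _ _ f Hk D1 If).
      + exact (composes_assoc_r _ _ _ _ _ f Hk D2 If).
  Qed.

  Lemma sop_section f h :
    is_section (star (ftm f) (cod f) h (cod_ftm f)) (sop f h).
  Proof.
    split; [|split].
    - rewrite dom_sop, ft_star, dom_ftm; reflexivity.
    - apply cod_sop.
    - rewrite ft_star, dom_ftm; apply p_sop.
  Qed.
End IteratedPullbackTheory.

(** * Images of objects and sections under a homomorphism of pre-B-systems *)

Section Reconstruction.
  Context {C D : Csystem} (F : Bhom (uB C) (uB D)).

  (** Placing [X] in the component of its own length turns the graded family of maps into one map on
      all objects. *)
  Definition ob_image (X : Ob C) : Ob D :=
    proj1_sig (onB F (exist _ X eq_refl : B (uB C) (len X)) : obn D (len X)).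

  Lemma onB_ob_image n (X : B (uB C) n) :
    proj1_sig (onB F X : obn D n) = ob_image (proj1_sig (X : obn C n)).
  Proof. destruct X as [X E]; subst n; reflexivity. Qed.

  Lemma sec_ob_onBt n (r : Bt (uB C) n) :
    sec_ob (onBt F r : secn D n) = ob_image (sec_ob (r : secn C n)).
  Proof.
    pose proof (onB_ob_image (S n) (bd n r)) as E; rewrite bhom_bd in E; exact E.
  Qed.

  Lemma len_ob_image X : len (ob_image X) = len X.
  Proof. exact (proj2_sig (onB F (exist _ X eq_refl : B (uB C) (len X)) : obn D _)). Qed.

  Lemma ob_image_pt : ob_image (pt C) = pt D.
  Proof.
    pose proof (onB_ob_image 0 (ptB (uB C))) as E; rewrite bhom_pt in E; symmetry; exact E.
  Qed.

  Lemma ob_image_ft X : ob_image (ft X) = ft (ob_image X).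
  Proof.
    destruct (len X) as [|n] eqn:E.
    (* [bhom_ft] concerns positive lengths only; in length zero both sides are [pt]. *)
    - apply len_eq0 in E; subst X; rewrite ft_pt, ob_image_pt, ft_pt; reflexivity.
    - pose (x := exist _ X E : B (uB C) (S n)).
      pose proof (onB_ob_image n (ftB n x)) as E1; rewrite bhom_ft in E1.
      rewrite <- (onB_ob_image (S n) x : _ = ob_image X); symmetry; exact E1.
  Qed.

  Lemma ob_image_ftI i X : ob_image (ftI i X) = ftI i (ob_image X).
  Proof.
    revert X; induction i as [|i IH]; intros X; [reflexivity|].
    simpl; rewrite IH, ob_image_ft; reflexivity.
  Qed.

  (** A relation between bare morphisms avoids transports between the types [secn C n] for provably
      equal indices. *)
  Definition sec_image (s : Mor C) (s' : Mor D) : Prop :=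
    exists n (r : secn C n),
      sec_mor r = s /\ sec_mor (onBt F (r : Bt (uB C) n) : secn D n) = s'.

  (** The morphism [s] determines its witness [r]: the object is the codomain of [s], and its length
      fixes [n]. *)
  Lemma sec_image_fun s s1 s2 : sec_image s s1 -> sec_image s s2 -> s1 = s2.
  Proof.
    intros [n [r [E <-]]] [n' [r' [E' <-]]].
    assert (Eo : sec_ob r = sec_ob r').
    { rewrite <- (proj1 (proj2 (sec_ax r))), <- (proj1 (proj2 (sec_ax r'))).
      congruence. }
    assert (En : n = n').
    { apply eq_add_S; rewrite <- (sec_len r), <- (sec_len r'), Eo; reflexivity. }
    subst n'; replace r' with r; [reflexivity|].
    apply secn_eq; congruence.
  Qed.

  Lemma sec_image_onBt n (r : secn C n) :
    sec_image (sec_mor r) (sec_mor (onBt F (r : Bt (uB C) n) : secn D n)).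
  Proof. exists n, r; split; reflexivity. Qed.

  (* A morphism f' of D is the image of f as soon as base change along f',
     on objects and on sections, is the image of base change along f. *)
  Record related (f : Mor C) (f' : Mor D) : Prop := Related {
    related_dom : dom f' = ob_image (dom f);
    related_cod : cod f' = ob_image (cod f);
    related_starI : forall i X h e h' e',
      ob_image (starI i f X h e) = starI i f' (ob_image X) h' e';
    related_sec_starI : forall j n (r : secn C n) h e h' e',
      sec_image (sec_starI j f (sec_ax r) h e)
           (sec_starI j f' (sec_ax (onBt F (r : Bt (uB C) n) : secn D n)) h' e')
  }.

  (** * Closure properties of related pairs *)

  Lemma related_cod_ftI f f' i X : related f f' ->
    cod f = ftI i X -> cod f' = ftI i (ob_image X).
  Proof. intros R e; rewrite (related_cod _ _ R), e; apply ob_image_ftI. Qed.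

  Lemma related_idm X : related (idm X) (idm (ob_image X)).
  Proof.
    split.
    - rewrite !dom_idm; reflexivity.
    - rewrite !cod_idm; reflexivity.
    - intros i Y h e h' e'.
      rewrite !starI_idm; [reflexivity | |]; [rewrite <- e' | rewrite <- e];
        rewrite cod_idm; reflexivity.
    - intros j n r h e h' e'.
      rewrite !sec_starI_idm; [apply sec_image_onBt | |];
        [rewrite <- e' | rewrite <- e]; rewrite cod_idm; reflexivity.
  Qed.

  Lemma related_composes g f k g' f' k' :
    related f f' -> related g g' -> composes g f k -> composes g' f' k' ->
    related k k'.
  Proof.
    intros Rf Rg K K'.
    split.
    - rewrite (composes_dom _ _ _ K), (composes_dom _ _ _ K').
      apply related_dom, Rf.
    - rewrite (composes_cod _ _ _ K), (composes_cod _ _ _ K').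
      apply related_cod, Rg.
    - intros i X h e h' e'.
      assert (eg : cod g = ftI i X) by (rewrite <- e, (composes_cod _ _ _ K); reflexivity).
      pose proof (related_cod_ftI _ _ i X Rg eg) as eg'.
      assert (hf : i <= len (starI i g X h eg)) by (rewrite len_starI; lia).
      assert (ef : cod f = ftI i (starI i g X h eg))
        by (rewrite ftI_starI; exact (composes_mid _ _ _ K)).
      assert (hf' : i <= len (starI i g' (ob_image X) h' eg')) by (rewrite len_starI; lia).
      assert (ef' : cod f' = ftI i (starI i g' (ob_image X) h' eg'))
        by (rewrite ftI_starI; exact (composes_mid _ _ _ K')).
      rewrite (starI_composes i f g k X h eg e hf ef K).
      rewrite (starI_composes i f' g' k' (ob_image X) h' eg' e' hf' ef' K').
      assert (hf2 : i <= len (ob_image (starI i g X h eg))) by (rewrite len_ob_image; exact hf).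
      rewrite (related_starI _ _ Rf i _ hf ef hf2 (related_cod_ftI _ _ i _ Rf ef)).
      apply starI_congr; [reflexivity | apply related_starI, Rg].
    - intros j n r h e h' e'.
      set (X := sec_ob r) in *.
      assert (eg : cod g = ftI (S j) X)
        by (rewrite <- e, (composes_cod _ _ _ K); reflexivity).
      assert (eg' : cod g' = ftI (S j) (sec_ob (onBt F (r : Bt (uB C) n) : secn D n)))
        by (rewrite <- e', (composes_cod _ _ _ K'); reflexivity).
      assert (hf : S j <= len (starI (S j) g X h eg)) by (rewrite len_starI; lia).
      assert (ef : cod f = ftI (S j) (starI (S j) g X h eg))
        by (rewrite ftI_starI; exact (composes_mid _ _ _ K)).
      set (X' := sec_ob (onBt F (r : Bt (uB C) n) : secn D n)) in *.
      assert (hf' : S j <= len (starI (S j) g' X' h' eg')) by (rewrite len_starI; lia).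
      assert (ef' : cod f' = ftI (S j) (starI (S j) g' X' h' eg'))
        by (rewrite ftI_starI; exact (composes_mid _ _ _ K')).
      assert (El : len (starI (S j) g X h eg) = S (j + len (dom g)))
        by apply (len_starI (S j)).
      (* The pullback along [g] is again an element of [Bt], so the relatedness of [f] and [f'] can
         be applied to it. *)
      pose (r2 := SecN (starI (S j) g X h eg) (sec_starI j g (sec_ax r) h eg) El
                    (sec_starI_section j g (sec_ax r) h eg)).
      rewrite (sec_starI_composes j f g k X _ (sec_ax r) h eg e (sec_ax r2) hf ef K).
      rewrite (sec_starI_composes j f' g' k' X' _ _ h' eg' e'
                 (sec_starI_section j g' _ h' eg') hf' ef' K').
      pose (r2' := onBt F (r2 : Bt (uB C) _) : secn D _).
      assert (EX : sec_ob r2' = starI (S j) g' X' h' eg').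
      { unfold r2'; rewrite sec_ob_onBt; cbn -[starI].
        assert (h2 : S j <= len (ob_image X)) by (rewrite len_ob_image; exact h).
        rewrite (related_starI _ _ Rg (S j) X h eg h2
                   (related_cod_ftI _ _ (S j) X Rg eg)).
        apply starI_congr; [reflexivity | symmetry; apply sec_ob_onBt]. }
      assert (Es : sec_mor r2' = sec_starI j g' (sec_ax (onBt F (r : Bt (uB C) n) : secn D n)) h' eg').
      { apply (sec_image_fun (sec_mor r2)); [apply sec_image_onBt|].
        apply related_sec_starI, Rg. }
      (* By [EX] and [Es] the image of [r2] is the pullback along [g'], with which the base change
         along [f'] has to start. *)
      assert (h3 : S j <= len (sec_ob r2')) by (rewrite EX; exact hf').
      assert (e3 : cod f' = ftI (S j) (sec_ob r2')) by (rewrite EX; exact ef').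
      rewrite <- (sec_starI_eq j _ _ _ _ f' f' (sec_ax r2') h3 e3
                    (sec_starI_section j g' _ h' eg') hf' ef' eq_refl EX Es).
      exact (related_sec_starI _ _ Rf j _ r2 hf ef h3 e3).
  Qed.

  Lemma related_p X : related (p X) (p (ob_image X)).
  Proof.
    destruct (len X) as [|n] eqn:EX.
    (* [T] requires positive length. At [pt] the projection is an endomorphism of a final object,
       hence an identity. *)
    { assert (Ep : forall (E : Csystem), p (pt E) = idm (pt E)).
      { intros E; apply (final_unique (pt E)); [apply pt_final | | |];
          rewrite ?cod_p, ?dom_p, ?cod_idm, ?dom_idm, ?ft_pt; reflexivity. }
      apply len_eq0 in EX; subst X; rewrite ob_image_pt, !Ep, <- ob_image_pt.
      apply related_idm. }
    assert (Hlen : forall i Y, S i <= len Y -> cod (p X) = ftI (S i) Y ->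
                     len Y = S (i + n)).
    { intros i Y h e; rewrite cod_p in e; apply (f_equal len) in e.
      rewrite len_ftI in e by exact h; rewrite len_ft in e by lia; lia. }
    pose (x := exist _ X EX : obn C (S n)).
    assert (Hft : forall i (y : obn C (S i + n)), cod (p X) = ftI (S i) (proj1_sig y) ->
              obn_ft n x = ftn (obn C) obn_ft (S i) n y).
    { intros i y e; apply obn_eq; rewrite ftn_ftI, <- e; symmetry; apply cod_p. }
    split.
    - rewrite !dom_p; reflexivity.
    - rewrite !cod_p, ob_image_ft; reflexivity.
    (* [T] covers the levels from one on; at level zero base change returns the domain. *)
    - intros [|i] Y h e h' e'; [simpl; rewrite !dom_p; reflexivity|].
      pose (y := exist _ Y (Hlen i Y h e) : obn C (S i + n)).
      assert (e1 : @ftB (uB C) n x = ftn (B (uB C)) (@ftB (uB C)) (S i) n y)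
        by exact (Hft i y e).
      assert (e2 : @ftB (uB D) n (onB F (x : B (uB C) _))
                   = ftn (B (uB D)) (@ftB (uB D)) (S i) n (onB F (y : B (uB C) _)))
        by (rewrite <- bhom_ft, e1; apply bhom_ftn).
      pose proof (bhom_T F n i x y e1 e2) as H.
      apply (f_equal (@proj1_sig _ _)) in H.
      rewrite onB_ob_image in H; cbn -[starI] in H.
      transitivity (ob_image (starI (S i) (p X) Y (obn_ge (i := S i) (n := n) y)
                           (T_cod (i := S i) x y e1)));
        [f_equal; apply starI_congr; reflexivity|].
      etransitivity; [exact H|].
      apply starI_congr; [f_equal|]; apply (onB_ob_image (S _)).
    - intros j m r h e h' e'.
      assert (Em : m = j + n).
      { apply eq_add_S; rewrite <- (sec_len r); apply Hlen; assumption. }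
      subst m.
      assert (e1 : @ftB (uB C) n x
                   = ftn (B (uB C)) (@ftB (uB C)) (S j) n (@bd (uB C) (j + n) r))
        by exact (Hft j (secn_bd _ r) e).
      assert (e2 : @ftB (uB D) n (onB F (x : B (uB C) _))
                   = ftn (B (uB D)) (@ftB (uB D)) (S j) n
                       (@bd (uB D) (j + n) (onBt F (r : Bt (uB C) _))))
        by (rewrite <- bhom_ft, e1, <- bhom_bd; apply (bhom_ftn F (S j))).
      pose proof (bhom_Tt F n j x r e1 e2) as H.
      apply (f_equal (@sec_mor _ _)) in H.
      exists (S (j + n)), (uB_Tt n j x r e1); split.
      + apply sec_starI_eq; reflexivity.
      + etransitivity; [exact H|].
        apply sec_starI_eq; [f_equal; apply (onB_ob_image (S _)) | |]; reflexivity.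
  Qed.

  Lemma related_section n (s : secn C n) :
    related (sec_mor s) (sec_mor (onBt F (s : Bt (uB C) n) : secn D n)).
  Proof.
    pose (s' := onBt F (s : Bt (uB C) n) : secn D n); fold s'.
    pose proof (sec_ax s) as [ds [cs _]].
    pose proof (sec_ax s') as [ds' [cs' _]].
    pose proof (sec_ob_onBt n s) as Eob; fold s' in Eob.
    (* The codomain of a section indexed by [n] has length [S n], against [n] for the projection in
       [related_p]; hence the shift in the indices below. *)
    assert (Hlen : forall i Y, S i <= len Y -> cod (sec_mor s) = ftI (S i) Y ->
                     len Y = S (i + S n)).
    { intros i Y h e; rewrite cs in e; apply (f_equal len) in e.
      rewrite len_ftI, sec_len in e by exact h; lia. }
    assert (Hbd : forall i (y : obn C (S i + S n)),
              cod (sec_mor s) = ftI (S i) (proj1_sig y) ->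
              secn_bd n s = ftn (obn C) obn_ft (S i) (S n) y).
    { intros i y e; apply obn_eq; rewrite ftn_ftI, <- e; symmetry; exact cs. }
    assert (Ed : dom (sec_mor s') = ob_image (dom (sec_mor s)))
      by (rewrite ds, ds', Eob, ob_image_ft; reflexivity).
    split.
    - exact Ed.
    - rewrite cs, cs'; exact Eob.
    - intros [|i] Y h e h' e'; [symmetry; exact Ed|].
      pose (y := exist _ Y (Hlen i Y h e) : obn C (S i + S n)).
      assert (e1 : @bd (uB C) n s = ftn (B (uB C)) (@ftB (uB C)) (S i) (S n) y)
        by exact (Hbd i y e).
      assert (e2 : @bd (uB D) n s'
                   = ftn (B (uB D)) (@ftB (uB D)) (S i) (S n) (onB F (y : B (uB C) _)))
        by (unfold s'; rewrite <- bhom_bd, e1; apply bhom_ftn).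
      pose proof (bhom_S F n i s y e1 e2) as H.
      apply (f_equal (@proj1_sig _ _)) in H.
      rewrite onB_ob_image in H; cbn -[starI] in H.
      transitivity (ob_image (starI (S i) (sec_mor s) Y (obn_ge (i := S i) (n := S n) y)
                           (S_cod (i := S i) s y e1)));
        [f_equal; apply starI_congr; reflexivity|].
      etransitivity; [exact H|].
      apply starI_congr; [reflexivity | apply (onB_ob_image (S _))].
    - intros j m r h e h' e'.
      assert (Em : m = j + S n).
      { apply eq_add_S; rewrite <- (sec_len r); apply Hlen; assumption. }
      subst m.
      assert (e1 : @bd (uB C) n s
                   = ftn (B (uB C)) (@ftB (uB C)) (S j) (S n) (@bd (uB C) (j + S n) r))
        by exact (Hbd j (secn_bd _ r) e).
      assert (e2 : @bd (uB D) n s'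
                   = ftn (B (uB D)) (@ftB (uB D)) (S j) (S n)
                       (@bd (uB D) (j + S n) (onBt F (r : Bt (uB C) _))))
        by (unfold s'; rewrite <- bhom_bd, e1, <- bhom_bd; apply (bhom_ftn F (S j))).
      pose proof (bhom_St F n j s r e1 e2) as H.
      apply (f_equal (@sec_mor _ _)) in H.
      exists (j + n), (uB_St n j s r e1); split.
      + apply sec_starI_eq; reflexivity.
      + etransitivity; [exact H|].
        apply sec_starI_eq; reflexivity.
  Qed.

  Lemma related_star f f' X h e h' e' : related f f' ->
    ob_image (star f X h e) = star f' (ob_image X) h' e'.
  Proof.
    intros R.
    transitivity (ob_image (starI 1 f X h e)); [f_equal; apply star_eq; reflexivity|].
    rewrite (related_starI _ _ R 1 X h e h' e'); apply star_eq; reflexivity.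
  Qed.

  (** Base change along [q f X] is base change along [f] one level higher, and [related] covers all
      levels. *)
  Lemma related_q f f' X h e h' e' : related f f' ->
    related (q f X h e) (q f' (ob_image X) h' e').
  Proof.
    intros R; split.
    - rewrite !dom_q; symmetry; apply related_star, R.
    - rewrite !cod_q; reflexivity.
    - intros i Y h1 e1 h1' e1'.
      assert (E : X = ftI i Y) by (rewrite <- e1, cod_q; reflexivity).
      (* As [ftI i Y] is [X], of positive length, [Y] admits one more [ft]. *)
      assert (h2 : S i <= len Y).
      { pose proof (len_ftI i Y h1) as L; rewrite <- E in L; lia. }
      assert (e2 : cod f = ftI (S i) Y) by (rewrite ftI_S_ft, <- E; exact e).
      rewrite (starI_q i f X h e Y h1 e1 h2 e2 E).
      assert (h2' : S i <= len (ob_image Y)) by (rewrite len_ob_image; exact h2).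
      pose proof (related_cod_ftI _ _ (S i) Y R e2) as e2'.
      rewrite (starI_q i f' (ob_image X) h' e' (ob_image Y) h1' e1' h2' e2')
        by (rewrite E; apply ob_image_ftI).
      apply related_starI, R.
    - intros j n r h1 e1 h1' e1'.
      assert (E : X = ftI (S j) (sec_ob r)) by (rewrite <- e1, cod_q; reflexivity).
      assert (h2 : S (S j) <= len (sec_ob r)).
      { pose proof (len_ftI (S j) _ h1) as L; rewrite <- E in L; lia. }
      assert (e2 : cod f = ftI (S (S j)) (sec_ob r)) by (rewrite ftI_S_ft, <- E; exact e).
      rewrite (sec_starI_q j f X h e _ _ (sec_ax r) h1 e1 h2 e2 E).
      assert (h2' : S (S j) <= len (sec_ob (onBt F (r : Bt (uB C) n) : secn D n)))
        by (rewrite sec_ob_onBt, len_ob_image; exact h2).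
      assert (e2' : cod f' = ftI (S (S j)) (sec_ob (onBt F (r : Bt (uB C) n) : secn D n)))
        by (rewrite sec_ob_onBt; apply (related_cod_ftI _ _ (S (S j)) _ R e2)).
      rewrite (sec_starI_q j f' (ob_image X) h' e' _ _ _ h1' e1' h2' e2')
        by (rewrite sec_ob_onBt, E; apply ob_image_ftI).
      apply related_sec_starI, R.
  Qed.

  Lemma related_ftm f f' : related f f' -> related (ftm f) (ftm f').
  Proof.
    intros R.
    apply (related_composes (p (cod f)) f (ftm f) (p (cod f')) f' (ftm f') R).
    - rewrite (related_cod _ _ R); apply related_p.
    - apply ftm_composes.
    - apply ftm_composes.
  Qed.

  (** Compatibility with [delta] carries diagonal to diagonal. By [sop_diag] both sides are
      pullbacks of these, along [f] and along [f']. *)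
  Lemma sec_image_sop f f' h h' : related f f' -> sec_image (sop f h) (sop f' h').
  Proof.
    intros R.
    assert (exists n, len (cod f) = S n) as [n E] by (exists (len (cod f) - 1); lia).
    pose (x := exist _ (cod f) E : obn C (S n)).
    pose (d := uB_delta n x).
    pose (x' := onB F (x : B (uB C) (S n)) : obn D (S n)).
    assert (Ed : onBt F (d : Bt (uB C) _) = uB_delta n x') by apply (bhom_delta F n x).
    assert (Ec : cod f' = proj1_sig x')
      by (unfold x'; rewrite onB_ob_image; apply related_cod, R).
    assert (hd : 1 <= len (sec_ob d)) by apply len_star.
    assert (ed : cod f = ftI 1 (sec_ob d)) by (cbn; rewrite ft_star, dom_p; reflexivity).
    assert (hd' : 1 <= len (sec_ob (uB_delta n x'))) by apply len_star.
    assert (ed' : cod f' = ftI 1 (sec_ob (uB_delta n x')))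
      by (cbn; rewrite ft_star, dom_p; exact Ec).
    rewrite <- (sop_diag f (cod f) (obn_gt0 x) h (sec_ax d) hd ed eq_refl).
    rewrite <- (sop_diag f' _ (obn_gt0 x') h' (sec_ax (uB_delta n x')) hd' ed' Ec).
    (* Quantifying over [r'] and its side proofs allows the image of [d] to be exchanged for the
       diagonal of [x']. *)
    assert (H : forall (r' : secn D (S n)) hr er, onBt F (d : Bt (uB C) _) = r' ->
              sec_image (sec_starI 0 f (sec_ax d) hd ed) (sec_starI 0 f' (sec_ax r') hr er))
      by (intros r' hr er <-; apply related_sec_starI, R).
    exact (H (uB_delta n x') hd' ed' Ed).
  Qed.

  (** The two sections correspond under [F] by [sec_image_sop], and corresponding sections are
      related. *)
  Lemma related_sop f f' h h' : related f f' -> related (sop f h) (sop f' h').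
  Proof.
    intros R; destruct (sec_image_sop f f' h h' R) as [n [r [<- <-]]].
    apply related_section.
  Qed.

  (** * Uniqueness and existence of the related morphism *)

  Lemma related_len f f' : related f f' -> 0 < len (cod f) -> 0 < len (cod f').
  Proof. intros R; rewrite (related_cod _ _ R), len_ob_image; trivial. Qed.

  (** Induction makes [ftm f1] and [ftm f2] equal, functionality of [sec_image] makes the sections
      equal, and [q_sop] rebuilds [f1] and [f2] from these data. Over [pt], finality suffices. *)
  Lemma related_unique f f1 f2 : related f f1 -> related f f2 -> f1 = f2.
  Proof.
    remember (len (cod f)) as n eqn:E.
    revert f f1 f2 E; induction n as [|n IH]; intros f f1 f2 E R1 R2.
    - symmetry in E; apply len_eq0 in E.
      apply (final_unique (pt D)); [apply pt_final | | |];
        rewrite ?(related_cod _ _ R1), ?(related_cod _ _ R2), ?(related_dom _ _ R1),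
          ?(related_dom _ _ R2), ?E, ?ob_image_pt; reflexivity.
    - assert (h : 0 < len (cod f)) by lia.
      assert (Eft : ftm f1 = ftm f2).
      { apply (IH (ftm f)); [rewrite cod_ftm, len_ft; lia | |]; apply related_ftm;
          assumption. }
      assert (Es : sop f1 (related_len _ _ R1 h) = sop f2 (related_len _ _ R2 h))
        by (apply (sec_image_fun (sop f h)); apply sec_image_sop; assumption).
      apply (composes_fun _ _ _ _ (q_sop f1 (related_len _ _ R1 h))).
      rewrite Es.
      erewrite q_eq; [apply q_sop | exact Eft |].
      rewrite (related_cod _ _ R1), (related_cod _ _ R2); reflexivity.
  Qed.

  (** A morphism to [pt] is a composite of projections, one for each unit of length of its domain;
      hence the induction on the domain. *)
  Lemma related_exists_pt f : cod f = pt C -> exists f', related f f'.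
  Proof.
    remember (len (dom f)) as n eqn:E.
    revert f E; induction n as [|n IH]; intros f E e.
    - symmetry in E; apply len_eq0 in E.
      exists (idm (ob_image (pt C))).
      replace f with (idm (pt C)); [apply related_idm|].
      apply (final_unique (pt C)); rewrite ?cod_idm, ?dom_idm; try congruence.
      apply pt_final.
    - destruct (pt_final C (ft (dom f))) as [g [[dg cg] _]].
      destruct (IH g) as [g' Rg]; [rewrite dg, len_ft; lia | exact cg |].
      assert (K : composes g (p (dom f)) f).
      { destruct (composes_total g (p (dom f))) as [k K]; [rewrite cod_p; congruence|].
        replace f with k at 2; [exact K|].
        apply (final_unique (pt C)); [apply pt_final | | exact e |].
        - rewrite (composes_cod _ _ _ K); exact cg.
        - rewrite (composes_dom _ _ _ K); apply dom_p. }
      destruct (composes_total g' (p (ob_image (dom f)))) as [k' K'].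
      { rewrite cod_p, (related_dom _ _ Rg), dg, ob_image_ft; reflexivity. }
      exists k'; exact (related_composes _ _ _ _ _ _ (related_p _) Rg K K').
  Qed.

  (** By [q_sop], [f] is [q] of [ftm f] after the section [sop f h]. Induction handles [ftm f], and
      [related_section] the section. *)
  Lemma related_exists f : exists f', related f f'.
  Proof.
    remember (len (cod f)) as n eqn:E.
    revert f E; induction n as [|n IH]; intros f E.
    - apply related_exists_pt, len_eq0; symmetry; exact E.
    - assert (h : 0 < len (cod f)) by lia.
      destruct (IH (ftm f)) as [g' Rg]; [rewrite cod_ftm, len_ft; lia|].
      assert (h' : 0 < len (ob_image (cod f))) by (rewrite len_ob_image; exact h).
      assert (e' : cod g' = ft (ob_image (cod f)))
        by (rewrite (related_cod _ _ Rg), cod_ftm; apply ob_image_ft).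
      pose proof (related_q _ _ (cod f) h (cod_ftm f) h' e' Rg) as Rq.
      assert (El : len (star (ftm f) (cod f) h (cod_ftm f)) = S (len (dom f)))
        by (rewrite len_star_eq, dom_ftm; reflexivity).
      pose proof (related_section _ (SecN _ _ El (sop_section f h))) as Rs.
      simpl sec_mor at 1 in Rs.
      (* The images are composable in [D] because relatedness fixes their domains and codomains. *)
      destruct (composes_total _ _ (eq_trans (related_cod _ _ Rs)
        (eq_trans (f_equal ob_image (composes_mid _ _ _ (q_sop f h)))
           (eq_sym (related_dom _ _ Rq))))) as [k' K'].
      exists k'; exact (related_composes _ _ _ _ _ _ Rs Rq (q_sop f h) K').
  Qed.

  Lemma related_exists_unique f : exists! f', related f f'.
  Proof.
    destruct (related_exists f) as [f' R]; exists f'; split; [exact R|].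
    intros f2; apply related_unique, R.
  Qed.

  (** * The induced homomorphism of C-systems *)

  Definition mor_image (f : Mor C) : Mor D := the (related_exists_unique f).

  Lemma related_mor_image f : related f (mor_image f).
  Proof. apply the_spec. Qed.

  (** Through this lemma each closure property of [related] becomes a law of the homomorphism. *)
  Lemma mor_image_eq f f' : related f f' -> mor_image f = f'.
  Proof. apply the_unique. Qed.

  Definition fun_image : smallfun C D.
  Proof.
    refine (SmallFun C D ob_image mor_image _ _ _ _).
    - intros f; apply related_dom, related_mor_image.
    - intros f; apply related_cod, related_mor_image.
    - intros X; apply mor_image_eq, related_idm.
    - intros g f e e'; apply mor_image_eq.
      apply (related_composes g f _ (mor_image g) (mor_image f)); try apply related_mor_image;
        [exists e | exists e']; reflexivity.
  Defined.

  Definition chom_image : Chom C D.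
  Proof.
    refine (CHom C D fun_image _ _ _ _ _ _ _); simpl.
    - apply len_ob_image.
    - apply ob_image_pt.
    - apply ob_image_ft.
    - intros X; apply mor_image_eq, related_p.
    - intros f X h e h' e'; apply related_star, related_mor_image.
    - intros f X h e h' e'; apply mor_image_eq, related_q, related_mor_image.
    - intros f h h'; apply mor_image_eq, related_sop, related_mor_image.
  Defined.

  Lemma uB_chom_image : uB_hom chom_image = F.
  Proof.
    apply Bhom_ext.
    - intros n X; apply obn_eq; symmetry; apply onB_ob_image.
    - intros n s; apply secn_eq.
      + symmetry; apply sec_ob_onBt.
      + apply mor_image_eq, related_section.
  Qed.
End Reconstruction.

(** * Full faithfulness *)

(** Homomorphisms preserve base change. With [related_unique] this shows that [uB_hom H] determines
    [H] on morphisms. *)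
Lemma related_uB_hom {C D : Csystem} (H : Chom C D) f :
  related (uB_hom H) f (fmor H f).
Proof.
  split.
  - apply dom_fmor.
  - apply cod_fmor.
  - intros; apply chom_starI.
  - intros j n r h e h' e'.
    assert (El : len (starI (S j) f (sec_ob r) h e) = S (j + len (dom f)))
      by apply (len_starI (S j)).
    exists (j + len (dom f)), (SecN _ _ El (sec_starI_section j f (sec_ax r) h e)).
    split; [reflexivity|].
    apply chom_sec_starI; reflexivity.
Qed.

Theorem theorem2p4 : fully_faithful uB_functor.
Proof.
  split.
  - intros C D F; exists (chom_image F); apply uB_chom_image.
  - intros C D H H' E; apply Chom_ext.
    (* [ob_image (uB_hom H) X] computes to [H X]. *)
    + intros X; change (ob_image (uB_hom H) X = ob_image (uB_hom H') X).
      change (uB_hom H = uB_hom H') in E; rewrite E; reflexivity.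
    + intros f; apply (related_unique (uB_hom H) f); [apply related_uB_hom|].
      change (uB_hom H = uB_hom H') in E; rewrite E; apply related_uB_hom.
Qed.
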